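(* Let $q$ be such that $\pm q$ is a PV number (i.e. $q$ or $-q$ is a PV number) and let $\alpha \in \mathcal{O}_q$ satisfy $$0 < \min\{1, |\alpha|\} \, H_q(\alpha) < |q|.$$ Then $E_q(\alpha) \notin \mathbb{Q}(q)$ and $L_q(\alpha) \notin \mathbb{Q}(q)$. In particular, $\zeta_q(1) = \sum_{n=1}^{\infty} \frac{1}{q^n-1}$ is irrational whenever $\pm q$ is a PV number.
   Context: A real algebraic integer $\omega$ is called a Pisot–Vijayraghavan number (PV number) if $\omega > 1$ and all other Galois conjugates $\omega^{(j)}$ of $\omega$ satisfy $|\omega^{(j)}| < 1$ (in particular, integers greater than $1$ are PV numbers). For an algebraic integer $q \neq 0$, $n_q = [\mathbb{Q}(q):\mathbb{Q}]$; $\sigma_1, \ldots, \sigma_{n_q}$ denote the embeddings of $\mathbb{Q}(q)$ into $\mathbb{C}$, with $\sigma_1$ the identity; $\mathcal{O}_q$ is the ring of integers of $\mathbb{Q}(q)$. For $\alpha \in \mathbb{Q}(q)$, the $q$-relative height is $$H_q(\alpha) = \prod_{l=1}^{n_q} \max\{1, |\sigma_l(\alpha)|\}.$$ For $q$ with $|q| > 1$, set $[n]_q = q^n - 1$ and $[n]_q! = (q^n-1)(q^{n-1}-1)\cdots(q-1)$. The $q$-exponential function is $E_q(x) = 1 + \sum_{n=1}^{\infty} \frac{x^n}{[n]_q!}$, and the $q$-logarithm function is $L_q(x) = \sum_{n=1}^{\infty} \frac{x^n}{[n]_q}$ for $|x| < |q|$. (The hypothesis on $\alpha$ implies $|\alpha|<|q|$,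 so $L_q(\alpha)$ is defined.) *)

(* Defs.v *)
From HB Require Import structures.
From mathcomp Require Import all_boot all_order all_algebra.
From mathcomp Require Import complex.
From mathcomp Require Import all_classical all_reals all_analysis.

Set Implicit Arguments.
Unset Strict Implicit.
Unset Printing Implicit Defensive.

Import Order.TTheory GRing.Theory Num.Theory.
Import numFieldNormedType.Exports.

Local Open Scope classical_set_scope.
Local Open Scope ring_scope.
Local Open Scope complex_scope.

Section NumberField.
Variable R : realType.
Implicit Types q w : R.

(* Q(q) is the smallest subfield of R containing q.  A divring-closed subset
   of the field R is the same thing as a subfield. *)
Definition adjoinQ q : {pred R} :=
  fun x => `[< forall S : {pred R}, divring_closed S -> q \in S -> x \in S >].

Lemma adjoinQ_divring_closed q : divring_closed (adjoinQ q).
Proof.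
split=> [|x y /asboolP xQ /asboolP yQ|x y /asboolP xQ /asboolP yQ];
  apply/asboolP => S S_div qS; have [S1 SB SV] := S_div => //.
- by apply: SB; [exact: xQ | exact: yQ].
- by apply: SV; [exact: xQ | exact: yQ].
Qed.

HB.instance Definition _ q :=
  GRing.isDivringClosed.Build R (adjoinQ q) (adjoinQ_divring_closed q).

Record numField q := NumField {
  numField_val :> R;
  numField_valP : numField_val \in adjoinQ q
}.

HB.instance Definition _ q := [isSub for @numField_val q].
HB.instance Definition _ q := [Choice of numField q by <:].
HB.instance Definition _ q := [SubChoice_isSubIntegralDomain of numField q by <:].
HB.instance Definition _ q := [SubIntegralDomain_isSubField of numField q by <:].

Definition ringOfIntegers q : set (numField q) :=
  [set a | integralOver (intr : int -> numField q) a].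

(* Embeddings of Q(q) into C, as a set of functions: a ring morphism between
   fields is automatically injective. *)
Definition embeddings q : set (numField q -> R[i]) :=
  range (fun s : {rmorphism numField q -> R[i]} => s : numField q -> R[i]).

(* |z| as an element of R (the norm of the library on R[i] is R[i]-valued). *)
Definition cabs (z : R[i]) : R := ComplexField.Normc.normc z.

(* The set of embeddings is finite when q is algebraic, so that this is then
   the genuine finite product over all embeddings. *)
Definition relHeight q (a : numField q) : R :=
  \big[*%R/1]_(s \in @embeddings q) Num.max 1 (cabs (s a)).

(* z is a Galois conjugate of w (possibly w itself): z is a root of the
   minimal polynomial of w over Q. *)
Definition galoisConjugate w (z : R[i]) : Prop :=
  exists p : {poly rat}, [/\ irreducible_poly p, root (map_poly ratr p) w
                           & root (map_poly ratr p) z].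

Definition PV_number w : Prop :=
  [/\ integralOver (intr : int -> R) w, 1 < w
    & forall z : R[i], galoisConjugate w z -> z != w%:C -> cabs z < 1].

Definition qint q (n : nat) : R := q ^+ n - 1.

Definition qfact q (n : nat) : R := \prod_(1 <= k < n.+1) qint q k.

(* For 1 < |q| the partial sums converge for every x (qexp), for |x| < |q|
   (qlog), and qzeta1 is the value of qlog at 1. *)
Definition qexp q (x : R) : R :=
  1 + \big[+%R/0]_(1 <= n <oo) (x ^+ n / qfact q n).

Definition qlog q (x : R) : R := \big[+%R/0]_(1 <= n <oo) (x ^+ n / qint q n).

Definition qzeta1 q : R := \big[+%R/0]_(1 <= n <oo) (q ^+ n - 1)^-1.

End NumberField.

(* Main.v *)
From HB Require Import structures.
Require Import Defs.
From mathcomp Require Import all_boot all_order all_algebra all_field.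
From mathcomp Require Import complex ring lra zify.
From mathcomp Require Import all_classical all_reals all_analysis.

(** Clearing denominators in the series of E_q already produces algebraic
    integers that are too small to be nonzero, and the statement about L_q
    reduces to one about such a series.

    Let c_k be integral elements of Q(q) whose conjugates grow at most linearly
    in k, and suppose that the sum of c_k alpha^k / [k]_q! is 0.  Put
      beta_n = [n]_q! (c_0 + c_1 alpha / [1]_q! + ... + c_n alpha^n / [n]_q!),
    an algebraic integer of Q(q).
    - At the identity embedding, beta_n is minus [n]_q! times the tail of the
      series, hence O(n (|alpha| / |q|)^n) ([clearedSum_le_tail]).
    - At another embedding s, the PV hypothesis gives |s(q)| < 1, so the
      products of factors s(q)^j - 1 are bounded and s(beta_n) is
      O(n^2 max(1, |s(alpha)|)^n) ([clearedSum_le_disk]).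
    The product of |s(beta_n)| over all d embeddings is therefore
    O(n^(2d) theta^n), where
      theta = (|alpha| / |q|) prod_(s <> id) max(1, |s(alpha)|)
            = min(1, |alpha|) H_q(alpha) / |q| < 1,
    whereas it is at least 1 for a nonzero algebraic integer ([norm_ge1]).  So
    beta_n = 0 for all large n, and the recurrence
      beta_(n+1) = beta_n (q^(n+1) - 1) + c_(n+1) alpha^(n+1)
    yields c_n = 0 for all large n ([coefficients_eventually_zero]); a fixed
    denominator in the c_k is harmless.

    If e = E_q(alpha) were in Q(q), this would apply to c_0 = 1 - e and c_k = 1
    for k >= 1.  For L_q, the product E_q(-x) = prod_(m >= 1) (1 - x / q^m) shows
    that L_q(x) = sum_(m >= 1) x / (q^m - x) is -x times the logarithmic
    derivative of E_q(-x).  In terms of series this is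
      sum_k (L_q(x) + k) (-x)^k / [k]_q! = 0        ([qlog_log_derivative]),
    so if L_q(alpha) were in Q(q) the argument would apply to
    c_k = (-1)^k (L_q(alpha) + k), which vanishes for at most one k.  Finally
    zeta_q(1) = L_q(1), and H_q(1) = 1. *)

Set Implicit Arguments.
Unset Strict Implicit.

Import Order.TTheory GRing.Theory Num.Theory.
Import numFieldNormedType.Exports.

Local Open Scope classical_set_scope.
Local Open Scope ring_scope.

(** * Algebraic integers and rational norms *)

Lemma integralOver_rmorph {F L : nzRingType} (f : {rmorphism F -> L}) (x : F) :
  integralOver (intr : int -> F) x -> integralOver (intr : int -> L) (f x).
Proof.
move=> /(integral_rmorph f) [p p_mon px0]; exists p => //.
by rewrite (eq_map_poly (g := f \o intr))// => m; rewrite /= rmorph_int.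
Qed.

Lemma integralOver_fmorph {F : fieldType} {L : nzRingType} (f : {rmorphism F -> L}) (x : F) :
  integralOver (intr : int -> L) (f x) -> integralOver (intr : int -> F) x.
Proof.
move=> [p p_mon px0]; exists p => //; rewrite rootE -(fmorph_eq0 f) -horner_map.
by rewrite -map_poly_comp -rootE (eq_map_poly (g := intr))// => m /=; rewrite rmorph_int.
Qed.

(** The ring of integers is integrally closed: seen as an algebraic number, [r]
    has the monic minimal polynomial X - r, and this has integer coefficients. *)
Lemma rat_integral_int {F : numFieldType} (r : rat) :
  integralOver (intr : int -> F) (ratr r) -> r \is a Num.int.
Proof.
move=> /(integralOver_fmorph (f := ratr))/(integralOver_rmorph (ratr : {rmorphism rat -> algC})).
move=> [p p_mon pr0].
have: (ratr r : algC) \in Aint.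
  apply: root_monic_Aint pr0 _ _; first exact: monic_map.
  by apply/polyOverP => i; rewrite coef_map /= rpred_int.
move=> /(Cint_rat_Aint (Crat_rat r)) /intrP[m].
by rewrite -(ratr_int algC) => /fmorph_inj ->.
Qed.

Lemma irreducible_root_dvd {F : fieldType} {L : fieldType} (f : {rmorphism F -> L})
    (p g : {poly F}) (x : L) :
  irreducible_poly p -> root (map_poly f p) x ->
  root (map_poly f g) x = (p %| g).
Proof.
move=> p_irr px0; apply/idP/idP => [gx0|/dvdpP[h ->]]; last first.
  by rewrite rmorphM rootM px0 orbT.
have [//|] := boolP (p %| g); rewrite -(irreducible_poly_coprime g p_irr).
move=> /Bezout_eq1_coprimepP[[u v] /= uv1].
have := congr1 (fun h => (map_poly f h).[x]) uv1.
rewrite rmorphD !rmorphM hornerD !hornerM (rootP px0) (rootP gx0) !mulr0 addr0.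
by rewrite rmorph1 hornerC => /esym/eqP; rewrite oner_eq0.
Qed.

(** The norm from Q[X]/(p) to Q of the class of [g].  Multiplication by [g] on the
    basis of powers of X has a rational matrix [B], and evaluation at the roots
    of [p], that is the Vandermonde matrix, diagonalises it with the values
    g(w) as eigenvalues; the product of these values is hence det B. *)
Lemma prod_horner_roots_rat {L : fieldType} (f : {rmorphism rat -> L})
    (p g : {poly rat}) (z : seq L) :
  p \is monic -> map_poly f p = \prod_(w <- z) ('X - w%:P) -> uniq z ->
  exists r : rat, \prod_(w <- z) (map_poly f g).[w] = f r.
Proof.
move=> p_mon pE z_uniq; set d := size z.
have p0 : p != 0 by exact: monic_neq0.
have sp : size p = d.+1.
  by rewrite -(size_map_poly f) pE size_prod_XsubC.
pose a : 'rV[L]_d := \row_(k < d) z`_k.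
pose B := \matrix_(i < d, j < d) (('X^i * g) %% p)`_j.
have ap (k : 'I_d) : root (map_poly f p) z`_k.
  by rewrite pE root_prod_XsubC mem_nth.
have BV : map_mx f B *m Vandermonde d a =
          Vandermonde d a *m diag_mx (\row_k (map_poly f g).[z`_k]).
  apply/matrixP => i k; rewrite mul_mx_diag !mxE.
  have := congr1 (fun h => (map_poly f h).[z`_k]) (divp_eq ('X^i * g) p).
  rewrite rmorphM hornerM rmorphD rmorphM hornerD hornerM (rootP (ap k)) mulr0.
  rewrite add0r /= map_polyXn hornerXn => ->.
  rewrite (@horner_coef_wide _ d); last first.
    by rewrite size_map_poly -ltnS -sp ltn_modp.
  by apply: eq_bigr => j _; rewrite !mxE coef_map.
have Vn0 : \det (Vandermonde d a) != 0.
  rewrite det_Vandermonde; apply/prodf_neq0 => i _; apply/prodf_neq0 => j ij.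
  rewrite !mxE subr_eq0 nth_uniq//; apply: contraTneq ij => ->.
  by rewrite ltnn.
exists (\det B); have := congr1 determinant BV.
rewrite !det_mulmx mulrC => /(mulfI Vn0).
rewrite det_diag -det_map_mx => ->.
rewrite (big_nth 0) big_mkord; apply: eq_bigr => k _.
by rewrite !mxE.
Qed.

(** In characteristic zero an irreducible polynomial is coprime to its
    derivative. *)
Lemma irreducible_rat_closed_factor {L : closedFieldType} (f : {rmorphism rat -> L})
    (p : {poly rat}) :
  p \is monic -> irreducible_poly p ->
  exists2 z : seq L, uniq z & map_poly f p = \prod_(w <- z) ('X - w%:P).
Proof.
move=> p_mon p_irr; have [z] := closed_field_poly_normal (map_poly f p).
rewrite lead_coef_map (monicP p_mon) rmorph1 scale1r => pE.
exists z => //; rewrite -separable_prod_XsubC -pE separable_map.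
rewrite separable_poly.unlock irreducible_poly_coprime//.
have [sp _] := p_irr.
have p'0 : p^`() != 0.
  apply/eqP => /(congr1 (fun h : {poly rat} => h`_(size p).-2)).
  rewrite coef_deriv coef0 prednK ?ltn_predRL// -lead_coefE (monicP p_mon).
  by move/eqP; rewrite pnatr_eq0 -leqn0 leqNgt ltn_predRL sp.
apply/negP => /(dvdp_leq p'0); apply/negP; rewrite -ltnNge.
exact/lt_size_deriv/monic_neq0.
Qed.

(** * The embeddings of Q(q) *)

Lemma rmorph_horner_rat {F L : fieldType} (f : {rmorphism F -> L})
    (g : {poly rat}) (x : F) :
  f (map_poly ratr g).[x] = (map_poly ratr g).[f x].
Proof.
rewrite -horner_map /= -map_poly_comp_id0 ?ratr0 ?rmorph0//.
by congr (_.[_]); apply: eq_map_poly => r /=; rewrite fmorph_rat.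
Qed.

Lemma mem_adjoinQ {R : realType} (q : R) : q \in adjoinQ q.
Proof. by apply/asboolP => S _ qS. Qed.

Definition generator {R : realType} (q : R) : numField q :=
  NumField (mem_adjoinQ q).

Lemma numField_val_horner {R : realType} {q : R} (f : {poly rat}) (x : numField q) :
  numField_val (map_poly ratr f).[x] = (map_poly ratr f).[x : R].
Proof. exact: (rmorph_horner_rat (val : {rmorphism numField q -> R})). Qed.

Definition realEmbedding {R : realType} (q : R) : {rmorphism numField q -> R[i]} :=
  (real_complex R \o val)%FUN.

(** The polynomial expressions in an algebraic number already form a field, by
    Bezout with its minimal polynomial. *)
Lemma numFieldE {R : realType} {q : R} (p : {poly rat}) :
    irreducible_poly p -> root (map_poly ratr p) q ->
  forall x : numField q, exists f : {poly rat}, x = (map_poly ratr f).[generator q].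
Proof.
move=> p_irr pq0 x.
pose S : {pred R} := fun y => `[< exists f : {poly rat}, y = (map_poly ratr f).[q] >].
suff /asboolP[f xE] : (x : R) \in S.
  by exists f; apply: val_inj; rewrite /= xE numField_val_horner.
have /asboolP/(_ S) := numField_valP x; apply; last first.
  by apply/asboolP; exists 'X; rewrite map_polyX hornerX.
split.
- by apply/asboolP; exists 1; rewrite rmorph1 hornerC.
- move=> _ _ /asboolP[f ->] /asboolP[g ->]; apply/asboolP; exists (f - g).
  by rewrite rmorphB hornerD hornerN.
move=> _ _ /asboolP[f ->] /asboolP[g ->]; apply/asboolP.
have [gp|] := boolP (p %| g).
  exists 0; rewrite rmorph0 horner0.
  by move: gp; rewrite -(irreducible_root_dvd _ p_irr pq0) => /rootP ->; rewrite invr0 mulr0.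
rewrite -(irreducible_poly_coprime g p_irr) => /Bezout_eq1_coprimepP[[u v] /= uv1].
have := congr1 (fun h => (map_poly ratr h).[q]) uv1.
rewrite rmorphD !rmorphM hornerD !hornerM (rootP pq0) mulr0 add0r rmorph1 hornerC.
move=> vg; exists (f * v); rewrite rmorphM hornerM; congr (_ * _).
have g0 : (map_poly ratr g).[q] != 0 :> R.
  by apply: contra_eq_neq vg => ->; rewrite mulr0 eq_sym oner_neq0.
by apply: (mulIf g0); rewrite mulVf.
Qed.

(** The morphism sends f(q) to f(w).  This does not depend on [f]: two
    polynomials with the same value at q differ by a multiple of [p]. *)
Lemma embedding_of_root {R : realType} (q : R) (p : {poly rat}) (w : R[i]) :
  irreducible_poly p -> root (map_poly ratr p) q -> root (map_poly ratr p) w ->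
  exists s : {rmorphism numField q -> R[i]}, s (generator q) = w.
Proof.
move=> p_irr pq0 pw0.
have pg0 : (map_poly ratr p).[generator q] = 0.
  by apply: val_inj; rewrite /= numField_val_horner; exact/rootP.
have [F FE] := choice (numFieldE p_irr pq0).
have Fw (f : {poly rat}) (x : numField q) : x = (map_poly ratr f).[generator q] ->
    (map_poly ratr (F x)).[w] = (map_poly ratr f).[w].
  move=> xE; apply/eqP; rewrite -subr_eq0 -hornerN -hornerD -rmorphB.
  rewrite -rootE (irreducible_root_dvd _ p_irr pw0).
  rewrite -(irreducible_root_dvd _ p_irr pq0) rootE.
  have /(congr1 (@numField_val _ _)) := etrans (esym xE) (FE x).
  rewrite !numField_val_horner/= => fq.
  by rewrite rmorphB hornerD hornerN fq subrr.
pose s x := (map_poly ratr (F x)).[w].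
have sB : zmod_morphism s.
  move=> x y; rewrite /s (Fw (F x - F y)).
    by rewrite rmorphB hornerD hornerN.
  apply: val_inj; rewrite /= numField_val_horner rmorphB hornerD hornerN.
  rewrite -!(numField_val_horner _ (generator q)) -!FE.
  exact: (rmorphB (val : {rmorphism numField q -> R})).
have sM : monoid_morphism s.
  split=> [|x y]; rewrite /s.
    rewrite (Fw 1) ?rmorph1 ?hornerC//.
    by apply: val_inj; rewrite /= numField_val_horner !rmorph1 hornerC.
  rewrite (Fw (F x * F y)) ?rmorphM ?hornerM//.
  apply: val_inj; rewrite /= numField_val_horner rmorphM hornerM.
  rewrite -!(numField_val_horner _ (generator q)) -!FE.
  exact: (rmorphM (val : {rmorphism numField q -> R})).
pose sr : {rmorphism numField q -> R[i]} := HB.pack s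
  (GRing.isZmodMorphism.Build _ _ s sB) (GRing.isMonoidMorphism.Build _ _ s sM).
exists sr; rewrite /= /s (Fw 'X) ?map_polyX ?hornerX//.
by apply: val_inj; rewrite /= numField_val_horner map_polyX hornerX.
Qed.

Lemma rat_min_poly {R : realType} (q : R) : integralOver (intr : int -> R) q ->
  exists p : {poly rat}, [/\ p \is monic, irreducible_poly p & root (map_poly ratr p) q].
Proof.
move=> q_int.
have [||p [p_mon pq p_irr]] :=
  @minPoly_decidable_closure rat R[i] (ratr : {rmorphism rat -> R[i]}) q%:C%C.
- by move=> z; case: (pselect (exists r : rat, z = ratr r)) => ?; [left|right].
- have [f f_mon fq] := integralOver_rmorph (real_complex R) q_int.
  exists (map_poly intr f); first exact: monic_map.
  rewrite -map_poly_comp (eq_map_poly (g := intr))// => m.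
  by rewrite /= ratr_int.
exists p; split=> //; rewrite rootE -(fmorph_eq0 (real_complex R)).
by rewrite /= rmorph_horner_rat.
Qed.

(** The norm on R[i] takes its values in R[i]; its properties are transferred
    to the real-valued modulus through this identity. *)
Lemma cabsE {R : realType} (z : R[i]) : `|z| = (cabs z)%:C%C.
Proof. by case: z => a b; rewrite normc_def. Qed.

Lemma cabsM {R : realType} (x y : R[i]) : cabs (x * y) = cabs x * cabs y.
Proof. exact: Normc.normcM. Qed.

Lemma cabs_prod {R : realType} {I : Type} (r : seq I) (P : pred I) (F : I -> R[i]) :
  cabs (\prod_(i <- r | P i) F i) = \prod_(i <- r | P i) cabs (F i).
Proof. by apply: (big_morph _ cabsM); exact: Normc.normc1. Qed.

Lemma cabs_ge0 {R : realType} (z : R[i]) : 0 <= cabs z.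
Proof. by rewrite -lecR -cabsE normr_ge0. Qed.

Lemma cabsD {R : realType} (x y : R[i]) : cabs (x + y) <= cabs x + cabs y.
Proof. by rewrite -lecR rmorphD /= -!cabsE ler_normD. Qed.

Lemma cabsN {R : realType} (z : R[i]) : cabs (- z) = cabs z.
Proof. by apply: (fmorph_inj (real_complex R)); rewrite /= -!cabsE normrN. Qed.

Lemma cabs_real {R : realType} (x : R) : cabs x%:C%C = `|x|.
Proof. by rewrite /cabs /= expr0n addr0 sqrtr_sqr. Qed.

(** An embedding is determined by the image of q, which can be any root of [p];
    products over the embeddings are thus products over the roots. *)
Lemma embeddingsE {R : realType} (q : R) (p : {poly rat}) (z : seq R[i]) :
  irreducible_poly p -> root (map_poly ratr p) q ->
  map_poly ratr p = \prod_(w <- z) ('X - w%:P) -> uniq z ->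
  exists2 S : seq (numField q -> R[i]), uniq S & @embeddings R q = [set` S] /\
    forall f : {poly rat}, \prod_(s <- S) s (map_poly ratr f).[generator q] =
                      \prod_(w <- z) (map_poly ratr f).[w].
Proof.
move=> p_irr pq0 pE z_uniq.
have /choice[s sP] : forall w : R[i], exists s : numField q -> R[i],
    root (map_poly ratr p) w -> embeddings s /\ s (generator q) = w.
  move=> w; have [pw|npw] := boolP (root (map_poly ratr p) w).
    have [s sw] := embedding_of_root p_irr pq0 pw.
    by exists s => _; split=> //; exists s.
  by exists (fun=> 0).
have zP w : w \in z = root (map_poly ratr p) w by rewrite pE root_prod_XsubC.
exists (map s z).
  rewrite map_inj_in_uniq// => w w' /[!zP] /sP[_ sw] /sP[_ sw'] ss.
  by rewrite -sw -sw' ss.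
split; last first.
  move=> f; rewrite big_map; apply: eq_big_seq => w /[!zP] /sP[[r _ rs] sw].
  by rewrite -[in RHS]sw -rs rmorph_horner_rat.
apply/seteqP; split=> [_ [r _ <-]|_ /= /mapP[w /[!zP] /sP[? _] ->]//].
have pr : root (map_poly ratr p) (r (generator q)).
  rewrite rootE -rmorph_horner_rat.
  suff -> : (map_poly ratr p).[generator q] = 0 by rewrite rmorph0.
  by apply: val_inj; rewrite /= numField_val_horner; exact/rootP.
apply/mapP; exists (r (generator q)); first by rewrite zP.
have [[r' _ <-] r'q] := sP _ pr; apply/funext => x.
by have [f ->] := numFieldE p_irr pq0 x; rewrite !rmorph_horner_rat r'q.
Qed.

Lemma embeddings_seq {R : realType} (q : R) : integralOver (intr : int -> R) q ->
  exists2 r : seq (numField q -> R[i]), uniq r & @embeddings R q = [set` r].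
Proof.
move=> /rat_min_poly[p [p_mon p_irr pq]].
have [z z_uniq pE] := irreducible_rat_closed_factor (ratr : {rmorphism rat -> R[i]}) p_mon p_irr.
by have [S S_uniq [SE _]] := embeddingsE p_irr pq pE z_uniq; exists S.
Qed.

(** The norm of a nonzero algebraic integer is a nonzero rational integer. *)
Lemma norm_ge1 {R : realType} (q : R) (x : numField q) :
  integralOver (intr : int -> R) q -> ringOfIntegers x -> x != 0 ->
  1 <= \big[*%R/1]_(s \in @embeddings R q) cabs (s x).
Proof.
move=> /rat_min_poly[p [p_mon p_irr pq]] x_int x0.
have [z z_uniq pE] := irreducible_rat_closed_factor (ratr : {rmorphism rat -> R[i]}) p_mon p_irr.
have [S S_uniq [SE prodE]] := embeddingsE p_irr pq pE z_uniq.
have [f xE] := numFieldE p_irr pq x.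
have [r rE] := prod_horner_roots_rat f p_mon pE z_uniq.
rewrite SE -fsbig_seq// -cabs_prod.
have Semb s : s \in S -> embeddings s by move=> sS; rewrite SE.
have N0 : \prod_(s <- S) s x != 0.
  rewrite prodf_seq_neq0; apply/allP => s /Semb[s' _ <-] /=.
  by rewrite fmorph_eq0.
have N_int : integralOver (intr : int -> R[i]) (\prod_(s <- S) s x).
  rewrite big_seq; elim/big_ind: _ => [|a b|s /Semb[s' _ <-]].
  - exact: integral1.
  - exact: integral_mul.
  - exact: integralOver_rmorph.
move: N0 N_int; rewrite {}xE prodE {}rE => r0 /rat_integral_int/intrP[m rm].
move: r0; rewrite {}rm /= ratr_int intr_eq0 => m0.
by rewrite -(rmorph_int (real_complex R) m) cabs_real -intr_norm ler1z -gtz0_ge1 normr_gt0.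
Qed.

Lemma numField_denominator {R : realType} (q : R) (x : numField q) :
  integralOver (intr : int -> R) q ->
  exists2 m : int, m != 0 & ringOfIntegers (m%:~R * x).
Proof.
move=> q_int; have [p [p_mon p_irr pq]] := rat_min_poly q_int.
have [f ->] := numFieldE p_irr pq x.
have [g [m m0 ->]] := rat_poly_scale f; exists m => //.
apply: (@integralOver_fmorph _ _ (val : {rmorphism numField q -> R})).
rewrite rmorphM rmorph_int /= numField_val_horner /= map_polyZ hornerZ.
rewrite -map_poly_comp (eq_map_poly (g := intr)) => [|k]; last by rewrite /= ratr_int.
rewrite fmorphV /= ratr_int mulVKf ?intr_eq0//.
apply: integral_horner => //; apply/integral_poly => i; rewrite coef_map.
exact: integral_id.
Qed.

(** * Pisot numbers *)

Lemma PV_integral {R : realType} (q : R) : PV_number q \/ PV_number (- q) ->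
  integralOver (intr : int -> R) q.
Proof. by move=> [[]//|[/integral_opp]]; rewrite opprK. Qed.

Lemma PV_norm_gt1 {R : realType} (q : R) : PV_number q \/ PV_number (- q) -> 1 < `|q|.
Proof.
move=> [[_ q1 _]|[_ q1 _]]; first by rewrite (lt_le_trans q1)// ler_norm.
by rewrite -normrN (lt_le_trans q1)// ler_norm.
Qed.

(** The image of [q] under an embedding is a conjugate of [q]; up to sign it is
    either the PV number itself, and then the embedding is the inclusion, or one
    of the conjugates of modulus less than 1. *)
Lemma PV_conjugate {R : realType} (q : R) (s : {rmorphism numField q -> R[i]}) :
  PV_number q \/ PV_number (- q) ->
  s = realEmbedding q :> (numField q -> R[i]) \/ cabs (s (generator q)) < 1.
Proof.
move=> hq; have [p [_ p_irr pq]] := rat_min_poly (PV_integral hq).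
have [sq|sq] := eqVneq (s (generator q)) (realEmbedding q (generator q)).
  left; apply/funext => x; have [f ->] := numFieldE p_irr pq x.
  by rewrite !rmorph_horner_rat sq.
right.
have conj (w : numField q) : s w != realEmbedding q w -> PV_number (w : R) ->
    cabs (s w) < 1.
  move=> sw [w_int _]; apply => //.
  have [f [_ f_irr fw]] := rat_min_poly w_int; exists f; split=> //.
  rewrite rootE -rmorph_horner_rat fmorph_eq0.
  by apply/eqP/val_inj; rewrite /= numField_val_horner; exact/rootP.
case: hq => hq; first exact: conj.
rewrite -cabsN -rmorphN.
apply: conj; first by rewrite !rmorphN eqr_opp.
by rewrite [X in PV_number X](rmorphN (val : {rmorphism numField q -> R})).
Qed.

(** * Geometric estimates *)

Lemma geometric_sum_le {R : realType} (r : R) (m n : nat) : 0 <= r < 1 ->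
  \sum_(m <= j < n) r ^+ j <= (1 - r)^-1.
Proof.
move=> /andP[r0 r1]; have r1' : 0 < 1 - r by rewrite subr_gt0.
have le_all : \sum_(m <= j < n) r ^+ j <= \sum_(0 <= j < n) r ^+ j.
  have [mn|/ltnW nm] := leqP m n; last first.
    by rewrite big_geq ?sumr_ge0// => i _; exact: exprn_ge0.
  by rewrite (big_cat_nat (n := m) (m := 0))//= lerDr sumr_ge0// => i _; exact: exprn_ge0.
apply: (le_trans le_all); rewrite -div1r ler_pdivlMr//.
have := subrX1 r n; rewrite big_mkord => h.
have : 0 <= r ^+ n by exact: exprn_ge0.
by nra.
Qed.

Lemma prod_1p_geometric_le {R : realType} (r : R) (m n : nat) : 0 <= r < 1 ->
  \prod_(m <= j < n) (1 + r ^+ j) <= expR (1 - r)^-1.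
Proof.
move=> r01; have /andP[r0 _] := r01.
apply: (@le_trans _ _ (expR (\sum_(m <= j < n) r ^+ j))).
  rewrite expR_sum; apply: ler_prod => j _; rewrite expR_ge1Dx andbT.
  by rewrite addr_ge0// exprn_ge0.
by rewrite ler_expR geometric_sum_le.
Qed.

(** Each of the first n + 1 terms of the geometric series is at least r^n. *)
Lemma linear_geometric_bounded {R : realType} (r : R) (n : nat) : 0 <= r < 1 ->
  n.+1%:R * r ^+ n <= (1 - r)^-1.
Proof.
move=> r01; have /andP[r0 /ltW r1] := r01.
apply: le_trans (geometric_sum_le 0 n.+1 r01).
rewrite mulr_natl -[X in _ *+ X]subn0 -sumr_const_nat big_nat [leRHS]big_nat.
by apply: ler_sum => j /andP[_ jn]; rewrite ler_wiXn2l.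
Qed.

(** Writing r = t^(k+1), the left-hand side is A ((n+1) t^n)^k t^n, where the
    base of the k-th power is bounded. *)
Lemma poly_geometric_lt1 {R : realType} (r A : R) (k : nat) : 0 <= r < 1 ->
  \forall n \near \oo, A * n.+1%:R ^+ k * r ^+ n < 1.
Proof.
move=> /andP[r0 r1]; pose t := r `^ (k.+1%:R^-1).
have tk : t ^+ k.+1 = r by rewrite -powR_mulrn ?powR_ge0// -powRrM mulVf ?powRr1.
have t0 : 0 <= t by exact: powR_ge0.
have t1 : t < 1 by rewrite -(@ltr_pXn2r _ k.+1) ?nnegrE ?expr1n ?tk.
have t01 : 0 <= t < 1 by rewrite t0.
pose B := `|A| * (1 - t)^-1 ^+ k.
have cv : geometric B t n @[n --> \oo] --> 0.
  by apply: cvg_geometric; rewrite ger0_norm.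
near=> n; apply: (@le_lt_trans _ _ (geometric B t n)); last first.
  by near: n; apply: (cvgr_lt _ cv).
have -> : A * n.+1%:R ^+ k * r ^+ n = A * (n.+1%:R * t ^+ n) ^+ k * t ^+ n.
  by rewrite -tk -exprM mulSn exprD exprMn -exprM (mulnC n k); ring.
have tn : 0 <= t ^+ n by exact: exprn_ge0.
rewrite /geometric /= ler_wpM2r// (le_trans (ler_wpM2r _ (ler_norm A)))//.
  by rewrite exprn_ge0// mulr_ge0.
rewrite ler_wpM2l// lerXn2r// ?nnegrE ?mulr_ge0// ?linear_geometric_bounded//.
by rewrite invr_ge0 subr_ge0 ltW.
Unshelve. all: by end_near. Qed.

(** * Series whose terms eventually halve *)

(** The halving hypothesis makes the left-hand side nonincreasing in [m]; its
    second term leaves room for the next summands. *)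
Lemma halving_sum_le {R : realType} (s : R^nat) (N n m : nat) :
  (forall k, 0 <= s k) -> (forall k, (N <= k)%N -> s k.+1 <= s k / 2) ->
  (N <= n)%N -> \sum_(n <= k < n + m) s k + 2 * s (n + m)%N <= 2 * s n.
Proof.
move=> s0 sN Nn; elim: m => [|m IH].
  by rewrite addn0 big_geq// add0r.
rewrite addnS big_nat_recr ?leq_addr//=; apply: le_trans IH.
have := sN (n + m)%N (leq_trans Nn (leq_addr _ _)).
by lra.
Qed.

Lemma halving_tail_le {R : realType} (f s : R^nat) (N : nat) (l : R) :
  (forall k, `|f k| <= s k) -> (forall k, (N <= k)%N -> s k.+1 <= s k / 2) ->
  series f @ \oo --> l -> forall n, (N <= n)%N -> `|l - series f n| <= 2 * s n.
Proof.
move=> fs sN fl n Nn; have s0 k : 0 <= s k by exact: le_trans (fs k).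
have dl : series f m - series f n @[m --> \oo] --> l - series f n.
  by apply: cvgB => //; exact: cvg_cst.
apply: (cvgr_to_le (cvg_norm dl)).
near=> m; have nm : (n <= m)%N by near: m; exact: nbhs_infty_ge.
rewrite sub_series_geq// (le_trans (ler_norm_sum _ _ _))//.
have := halving_sum_le (m - n) s0 sN Nn; rewrite subnKC// => h.
apply: (@le_trans _ _ (\sum_(n <= k < m) s k)); first exact: ler_sum.
have := s0 m; move: h; lra.
Unshelve. all: by end_near. Qed.

Lemma halving_cvg {R : realType} (f s : R^nat) (N : nat) :
  (forall k, `|f k| <= s k) -> (forall k, (N <= k)%N -> s k.+1 <= s k / 2) ->
  cvgn [normed series f].
Proof.
move=> fs sN; have s0 k : 0 <= s k by exact: le_trans (fs k).
apply: nondecreasing_is_cvgn; first by apply: nondecreasing_series => k _ _; exact: normr_ge0.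
exists (\sum_(0 <= k < N) `|f k| + 2 * s N) => _ [n _ <-] /=.
have -> : series (fun k => `|f k|) n = \sum_(0 <= k < n) `|f k| by [].
apply: (@le_trans _ _ (\sum_(0 <= k < N + n) `|f k|)).
  rewrite [leRHS](big_cat_nat (n := n)) ?leq_addl//= lerDl sumr_ge0//.
rewrite (big_cat_nat (n := N)) ?leq_addr//= lerD2l.
have := halving_sum_le n s0 sN (leqnn N) => h.
apply: (@le_trans _ _ (\sum_(N <= k < N + n) s k)); first exact: ler_sum.
have := s0 (N + n)%N; move: h; lra.
Qed.

(** Quantitative continuity at 0 of the power series with coefficients [f]: its
    value at [t] differs from the constant term by O(t). *)
Lemma series_dilation {R : realType} (f : R^nat) : cvgn [normed series f] ->
  exists2 C : R, 0 <= C & forall t : R, `|t| <= 1 ->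
    exists l : R, series (fun k => f k * t ^+ k) @ \oo --> l /\ `|l - f 0%N| <= C * `|t|.
Proof.
move=> nf; pose C := limn [normed series f].
have nfC n : series (fun k => `|f k|) n <= C.
  apply: nondecreasing_cvgn_le => //.
  by apply: nondecreasing_series => k _ _; exact: normr_ge0.
exists C; first by apply: le_trans (nfC 0%N); rewrite /series /= big_geq.
move=> t t1; have ft_le k : `|f k * t ^+ k| <= `|f k|.
  by rewrite normrM normrX ler_piMr// exprn_ile1.
have /normed_cvg/cvg_ex[l fl] : cvgn [normed series (fun k => f k * t ^+ k)].
  by apply: (series_le_cvg (v_ := fun k => `|f k|)) => // k; exact: normr_ge0.
exists l; split=> //.
have dl : series (fun k => f k * t ^+ k) n - f 0%N @[n --> \oo] --> l - f 0%N.
  by apply: cvgB => //; exact: cvg_cst.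
apply: (cvgr_to_le (cvg_norm dl)).
near=> n'; have n'0 : (0 < n')%N by near: n'; exact: nbhs_infty_gt.
rewrite -(prednK n'0); set n := n'.-1.
rewrite /series /= big_nat_recl//= expr0 mulr1 addrAC subrr add0r.
rewrite (le_trans (ler_norm_sum _ _ _))//.
apply: (@le_trans _ _ (\sum_(0 <= k < n) `|f k.+1| * `|t|)).
  apply: ler_sum => k _; rewrite exprS mulrCA mulrC normrM ler_wpM2r//.
  by rewrite normrM normrX ler_piMr// exprn_ile1.
rewrite -mulr_suml ler_wpM2r//; apply: le_trans (nfC n.+1).
by rewrite /series /= big_nat_recl//= lerDr.
Unshelve. all: by end_near. Qed.

(** * Series with q-factorial denominators *)

Lemma qfactS {R : realType} (q : R) (n : nat) : qfact q n.+1 = qfact q n * qint q n.+1.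
Proof. by rewrite /qfact big_nat_recr. Qed.

Lemma qfact0 {R : realType} (q : R) : qfact q 0 = 1.
Proof. by rewrite /qfact big_geq. Qed.

Lemma qint_ge {R : realType} (q : R) (n : nat) : 1 < `|q| ->
  `|q| ^+ n.+1 * (1 - `|q|^-1) <= `|qint q n.+1|.
Proof.
move=> q1; have q0 : `|q| != 0 by rewrite gt_eqF// (lt_trans ltr01).
rewrite mulrBr mulr1 {2}exprSr mulfK// /qint.
apply: (@le_trans _ _ (`|q| ^+ n.+1 - 1)).
  by rewrite lerD2l lerN2 exprn_ege1// ltW.
by rewrite -normrX -[X in _ - X]normr1 lerB_dist.
Qed.

Lemma qgap_gt0 {R : realType} (q : R) : 1 < `|q| -> 0 < 1 - `|q|^-1.
Proof. by move=> q1; rewrite subr_gt0 invf_lt1// (lt_trans ltr01). Qed.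

Lemma qint_neq0 {R : realType} (q : R) (n : nat) : 1 < `|q| -> qint q n.+1 != 0.
Proof.
move=> q1; rewrite -normr_gt0 (lt_le_trans _ (qint_ge n q1))//.
by rewrite mulr_gt0 ?qgap_gt0// exprn_gt0// (lt_trans ltr01).
Qed.

Lemma qfact_neq0 {R : realType} (q : R) (n : nat) : 1 < `|q| -> qfact q n != 0.
Proof.
move=> q1; elim: n => [|n IH]; first by rewrite qfact0 oner_neq0.
by rewrite qfactS mulf_neq0// qint_neq0.
Qed.

(** The ratio of consecutive terms is at most 2 x / |q^(k+1) - 1|. *)
Lemma qfact_halving {R : realType} (q A x : R) : 1 < `|q| -> 0 <= A -> 0 <= x ->
  let s k := A * k.+1%:R * x ^+ k / `|qfact q k| in
  exists N, forall k, (N <= k)%N -> s k.+1 <= s k / 2.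
Proof.
move=> q1 A0 x0 s; have c0 := qgap_gt0 q1.
have q0 : 0 < `|q| by rewrite (lt_trans ltr01).
have r01 : 0 <= `|q|^-1 < 1 by rewrite invr_ge0 normr_ge0/= invf_lt1.
have [N _ NP] := poly_geometric_lt1 (4 * x / (1 - `|q|^-1)) 0 r01.
exists N => k /NP /=; rewrite expr0 mulr1 => kN.
have le4 : 4 * x <= `|qint q k.+1|.
  apply: le_trans (qint_ge k q1); rewrite -ler_pdivrMr//.
  move: kN; rewrite exprVn ltr_pdivrMr ?exprn_gt0// mul1r => /ltW/le_trans; apply.
  by rewrite exprS ler_peMl ?exprn_ge0// ltW.
have p1 : 0 < `|qint q k.+1| by rewrite normr_gt0 qint_neq0.
have p0 : 0 < `|qfact q k| by rewrite normr_gt0 qfact_neq0.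
rewrite /s qfactS normrM exprS.
have -> : A * k.+2%:R * (x * x ^+ k) / (`|qfact q k| * `|qint q k.+1|) =
   (A * x ^+ k / `|qfact q k|) * (k.+2%:R * x / `|qint q k.+1|).
  by field; rewrite !gt_eqF.
have -> : A * k.+1%:R * x ^+ k / `|qfact q k| / 2 =
   (A * x ^+ k / `|qfact q k|) * (k.+1%:R / 2).
  by field; rewrite !gt_eqF.
rewrite ler_wpM2l ?divr_ge0 ?mulr_ge0 ?exprn_ge0//.
rewrite ler_pdivrMr//.
have kx : 0 <= k%:R * x by rewrite mulr_ge0.
have k1 : 0 <= k%:R + 1 :> R by rewrite natr1.
move: (ler_wpM2l k1 le4) kx; rewrite -[k.+2%:R]natr1 -[k.+1%:R]natr1; lra.
Qed.

Lemma qfact_dominated_cvg {R : realType} (q A x : R) (f : R^nat) :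
  1 < `|q| -> 0 <= A -> (forall k, `|f k| <= A * k.+1%:R * `|x| ^+ k / `|qfact q k|) ->
  cvgn [normed series f].
Proof.
move=> q1 A0 fle; have [N NP] := qfact_halving q1 A0 (normr_ge0 x).
exact: halving_cvg fle NP.
Qed.

Lemma qlog_cvg {R : realType} (q x : R) : 1 < `|q| -> `|x| < `|q| ->
  cvgn [normed series (fun k => x ^+ k / qint q k)].
Proof.
move=> q1 xq; have c0 := qgap_gt0 q1; have q0 : 0 < `|q| by rewrite (lt_trans ltr01).
apply: (series_le_cvg (v_ := geometric (1 - `|q|^-1)^-1 (`|x| / `|q|))) => [k|k|k|].
- exact: normr_ge0.
- by rewrite /geometric /= mulr_ge0 ?invr_ge0 ?exprn_ge0 ?divr_ge0// ltW.
- rewrite /geometric /=; case: k => [|k].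
    by rewrite /qint expr0 subrr invr0 mulr0 normr0 mulr1 invr_ge0 ltW.
  rewrite normrM normfV normrX expr_div_n mulrCA ler_wpM2l ?exprn_ge0//.
  rewrite -invfM lef_pV2 ?posrE ?normr_gt0 ?qint_neq0 ?mulr_gt0 ?exprn_gt0//.
  by rewrite mulrC qint_ge.
apply: is_cvg_geometric_series.
by rewrite ger0_norm ?divr_ge0// ltr_pdivrMr// mul1r.
Qed.

(** * L_q as a logarithmic derivative *)

(** Comparing the values of a power series at [q * t] and at [t] multiplies the
    k-th coefficient by q^k - 1, which cancels one q-integer of the
    denominator. *)
Lemma series_qstep {R : realType} (q t A B : R) (a b : R^nat) :
  (forall k, a k.+1 * qint q k.+1 = b k) ->
  series (fun k => a k * t ^+ k) @ \oo --> A ->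
  series (fun k => b k * t ^+ k) @ \oo --> B ->
  series (fun k => a k * (q * t) ^+ k) @ \oo --> A + t * B.
Proof.
move=> ab aA bB; rewrite -(cvg_shiftn 1) /=.
have -> : (fun n => series (fun k => a k * (q * t) ^+ k) (n + 1)%N) =
  (fun n => series (fun k => a k * t ^+ k) (n + 1)%N +
            t * series (fun k => b k * t ^+ k) n).
  apply/funext => n; rewrite addn1 /series /=.
  rewrite [LHS]big_nat_recl//= [in RHS]big_nat_recl//= !expr0 -addrA; congr +%R.
  rewrite mulr_sumr -big_split /=; apply: eq_bigr => k _.
  by rewrite -ab /qint exprMn !exprS; ring.
apply: cvgD; first by rewrite (cvg_shiftn 1).
exact: cvgMl_tmp.
Qed.

Lemma cvg_seriesM {R : realType} (c A : R) (a : R^nat) :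
  series a @ \oo --> A -> series (fun k => c * a k) @ \oo --> c * A.
Proof.
move=> aA; rewrite (_ : series _ = fun n => c * series a n).
  exact: cvgMl_tmp.
by apply/funext => n; rewrite /series /= mulr_sumr.
Qed.

(** The term of index 0 vanishes, because its denominator is q^0 - 1 = 0 and
    the inverse of 0 is 0. *)
Lemma qlogE {R : realType} (q x : R) : qlog q x = limn (series (fun k => x ^+ k / qint q k)).
Proof.
rewrite /qlog; suff <- : (fun n => \sum_(1 <= k < n) (x ^+ k / qint q k)) =
  series (fun k => x ^+ k / qint q k) by [].
apply/funext => -[|n].
  by rewrite /series /= !big_geq.
rewrite /series /= [RHS]big_nat_recl// big_add1 /= {2}/qint expr0 subrr invr0 mulr0 add0r.
by [].
Qed.

(** With F(y) = E_q(-y), G(y) = y F'(y) and W = L_q F + G, the functional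
    equations
      F(q y) = (1 - y) F(y),   G(q y) = (1 - y) G(y) - y F(y),
      L_q(q y) = L_q(y) + y / (1 - y)
    combine to W(q y) = (1 - y) W(y).  Iterating towards 0, W(x) is a bounded
    product times W(x / q^n), and W(y) = O(y) at 0, so W(x) = 0. *)
Lemma qlog_log_derivative {R : realType} (q x : R) : 1 < `|q| -> `|x| < `|q| ->
  series (fun k => (-1) ^+ k * (qlog q x + k%:R) * x ^+ k / qfact q k) @ \oo --> 0.
Proof.
move=> q1 xq; have q0 : 0 < `|q| by rewrite (lt_trans ltr01).
have qn0 : q != 0 by rewrite -normr_gt0.
(* The series f, g, h evaluated at t n = q^-n give the values F n, G n, H n of
   F, G and L_q at x / q^n. *)
pose f k := (- x) ^+ k / qfact q k.
pose g k := k%:R * f k.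
pose h k := x ^+ k / qint q k.
pose t n := q^-1 ^+ n.
pose r := `|q|^-1.
have r01 : 0 <= r < 1 by rewrite invr_ge0 normr_ge0/= invf_lt1.
have [r0 r1] := andP r01.
have tE n : `|t n| = r ^+ n by rewrite normrX normfV.
have t1 n : `|t n| <= 1 by rewrite tE exprn_ile1// ltW.
have qt n : q * t n.+1 = t n by rewrite /t exprS mulVKf.
have xt n : `|x * t n.+1| <= r ^+ n.
  by rewrite normrM tE exprS mulrA ler_piMl ?exprn_ge0// ler_pdivrMr// mul1r ltW.
have xt1 n : `|x * t n.+1| < 1.
  rewrite normrM tE exprS mulrA (@le_lt_trans _ _ (`|x| * r))//.
    by rewrite ler_piMr ?mulr_ge0 ?exprn_ile1// ltW.
  by rewrite ltr_pdivrMr// mul1r.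
have [CF CF0 fC] : exists2 C : R, 0 <= C & forall t : R, `|t| <= 1 ->
    exists l : R, series (fun k => f k * t ^+ k) @ \oo --> l /\ `|l - f 0%N| <= C * `|t|.
  apply: series_dilation; apply: (@qfact_dominated_cvg _ q 1 x) => // k.
  rewrite normrM normrX normrN normfV mul1r ler_wpM2r ?invr_ge0//.
  by rewrite ler_peMl ?exprn_ge0// ler1n.
have [CG CG0 gC] : exists2 C : R, 0 <= C & forall t : R, `|t| <= 1 ->
    exists l : R, series (fun k => g k * t ^+ k) @ \oo --> l /\ `|l - g 0%N| <= C * `|t|.
  apply: series_dilation; apply: (@qfact_dominated_cvg _ q 1 x) => // k.
  rewrite !normrM normrX normrN normfV mul1r mulrA ler_wpM2r ?invr_ge0//.
  by rewrite ler_wpM2r ?exprn_ge0// normr_nat ler_nat.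
have [CH CH0 hC] := series_dilation (qlog_cvg q1 xq).
have [F FP] := choice (fun n => fC (t n) (t1 n)).
have [G GP] := choice (fun n => gC (t n) (t1 n)).
have [H HP] := choice (fun n => hC (t n) (t1 n)).
have fS k : f k.+1 * qint q k.+1 = - x * f k.
  rewrite /f qfactS exprS; field.
  by rewrite qint_neq0// qfact_neq0.
have gS k : g k.+1 * qint q k.+1 = - x * (g k + f k).
  by rewrite /g -mulrA fS -natr1; ring.
have hS k : h k.+1 * qint q k.+1 = x * x ^+ k.
  by rewrite /h divfK ?qint_neq0// exprS.
have FS n : F n = F n.+1 + t n.+1 * (- x * F n.+1).
  apply: (cvg_unique _ (FP n).1) => //; rewrite -(qt n).
  apply: (series_qstep fS (FP n.+1).1).
  rewrite (_ : (fun k => _) = fun k => - x * (f k * t n.+1 ^+ k)).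
    exact: cvg_seriesM (FP n.+1).1.
  by apply/funext => k; rewrite mulrA.
have GS n : G n = G n.+1 + t n.+1 * (- x * (G n.+1 + F n.+1)).
  apply: (cvg_unique _ (GP n).1) => //; rewrite -(qt n).
  apply: (series_qstep gS (GP n.+1).1).
  rewrite (_ : (fun k => _) = fun k => - x * ((fun k => g k * t n.+1 ^+ k) \+
     (fun k => f k * t n.+1 ^+ k)) k); last first.
    by apply/funext => k /=; rewrite -mulrDl mulrA.
  apply: cvg_seriesM; rewrite [series _](seriesD).
  by apply: cvgD; [exact: (GP n.+1).1 | exact: (FP n.+1).1].
have HS n : H n = H n.+1 + t n.+1 * (x / (1 - x * t n.+1)).
  apply: (cvg_unique _ (HP n).1) => //; rewrite -(qt n).
  apply: (series_qstep hS (HP n.+1).1).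
  rewrite (_ : (fun k => _) = geometric x (x * t n.+1)); last first.
    by apply/funext => k; rewrite /geometric /= exprMn mulrA.
  exact: cvg_geometric_series.
pose W n := F n * H n + G n.
have WS n : W n = (1 - x * t n.+1) * W n.+1.
  have xt0 : 1 - x * t n.+1 != 0.
    by rewrite subr_eq0; apply: contraTneq (xt1 n) => <-; rewrite normr1 ltxx.
  by rewrite /W FS GS HS; field.
have W0 n : W 0%N = (\prod_(0 <= j < n) (1 - x * t j.+1)) * W n.
  elim: n => [|n IH]; first by rewrite big_geq// mul1r.
  by rewrite IH WS big_nat_recr//= mulrA.
have F_le n : `|F n| <= CF + `|f 0%N|.
  rewrite -[F n](subrK (f 0%N)) (le_trans (ler_normD _ _))// lerD2r.
  by rewrite (le_trans (FP n).2)// ler_piMr.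
have G_le n : `|G n| <= CG * r ^+ n.
  by have := (GP n).2; rewrite /g mul0r subr0 tE.
have H_le n : `|H n| <= CH * r ^+ n.
  by have := (HP n).2; rewrite /= /qint expr0 subrr invr0 mulr0 subr0 tE.
pose M := expR (1 - r)^-1 * ((CF + `|f 0%N|) * CH + CG).
have W0_le n : `|W 0%N| <= M * r ^+ n.
  rewrite (W0 n) normrM -mulrA ler_pM//.
    rewrite normr_prod; apply: le_trans (prod_1p_geometric_le 0 n r01).
    apply: ler_prod => j _; rewrite normr_ge0/=.
    by rewrite (le_trans (ler_normB _ _))// normr1 lerD2l.
  rewrite (le_trans (ler_normD _ _))// mulrDl lerD// normrM -mulrA.
  by rewrite ler_pM.
have W00 : W 0%N = 0.
  apply/eqP; rewrite -normr_eq0; apply: contraT => Wn0.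
  have Wp : 0 < `|W 0%N| by rewrite lt_def Wn0 normr_ge0.
  have [N _ /(_ N (leqnn N))] := poly_geometric_lt1 (M / `|W 0%N|) 0 r01.
  rewrite /= expr0 mulr1 mulrAC ltr_pdivrMr// mul1r ltNge.
  by rewrite W0_le.
have HE : H 0%N = qlog q x.
  rewrite qlogE; apply/esym/cvg_lim => //; have := (HP 0%N).1.
  rewrite (_ : (fun k => _) = h)//; apply/funext => k.
  by rewrite /t expr0 expr1n mulr1.
rewrite -W00 /W (_ : (fun k => _) = (fun k => H 0%N * (f k * t 0%N ^+ k)) \+
  (fun k => g k * t 0%N ^+ k)); last first.
  apply/funext => k /=; rewrite /g /f /t expr0 expr1n HE (exprNn x); ring.
rewrite [series _](seriesD); apply: cvgD; last exact: (GP 0%N).1.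
by rewrite mulrC; apply: cvg_seriesM; exact: (FP 0%N).1.
Qed.

(** * Partial sums cleared of their denominators *)

(** [n]_q! times the n-th partial sum of the series of c_k a^k / [k]_q!, see
    [clearedSumE].  The recursive form is a polynomial in the data, so it makes
    sense in any ring and commutes with morphisms. *)
Fixpoint clearedSum {F : nzRingType} (q a : F) (c : nat -> F) (n : nat) : F :=
  if n is m.+1 then clearedSum q a c m * (q ^+ n - 1) + c n * a ^+ n else c 0%N.

Lemma clearedSum_rmorph {F L : nzRingType} (f : {rmorphism F -> L}) (q a : F) c n :
  f (clearedSum q a c n) = clearedSum (f q) (f a) (f \o c) n.
Proof.
elim: n => //= n IH; rewrite rmorphD !rmorphM rmorphB !rmorphXn IH rmorph1.
by [].
Qed.

Lemma clearedSum_integral {F : fieldType} (q a : F) c n :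
  integralOver (intr : int -> F) q -> integralOver (intr : int -> F) a ->
  (forall k, integralOver (intr : int -> F) (c k)) ->
  integralOver (intr : int -> F) (clearedSum q a c n).
Proof.
move=> q_int a_int c_int.
have X_int x k : integralOver (intr : int -> F) x -> integralOver (intr : int -> F) (x ^+ k).
  move=> x_int; elim: k => [|k IH]; first exact: integral1.
  by rewrite exprS; exact: integral_mul.
elim: n => [|n IH]; first exact: c_int.
apply: integral_add; apply: integral_mul; [exact: IH | | exact: c_int | exact: X_int].
by apply: integral_sub; [exact: X_int | exact: integral1].
Qed.

Lemma clearedSumE {R : realType} (q a : R) (c : nat -> R) (n : nat) : 1 < `|q| ->
  clearedSum q a c n = qfact q n * series (fun k => c k * a ^+ k / qfact q k) n.+1.
Proof.
move=> q1; elim: n => [|n IH].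
  by rewrite /series /= big_nat1 qfact0 expr0 invr1 mulr1 mul1r mulr1.
rewrite /= {}IH [RHS](_ : _ = qfact q n.+1 * (series (fun k => c k * a ^+ k / qfact q k) n.+1 +
   c n.+1 * a ^+ n.+1 / qfact q n.+1)); last by rewrite /series /= [in LHS]big_nat_recr.
rewrite [RHS]mulrDr [X in _ = _ + X]mulrC divfK ?qfact_neq0// qfactS /qint.
by ring.
Qed.

(** When |q| < 1 the factors q^j - 1 are at most 1 + |q|^j, whose product
    converges.  The recurrence loses a factor of at most this size and adds a
    term of order n |a|^n, whence the square after summation. *)
Lemma clearedSum_le_disk {R : realType} (q a : R[i]) (c : nat -> R[i]) (A : R) :
  cabs q < 1 -> 0 <= A -> (forall k, cabs (c k) <= A * k.+1%:R) ->
  exists B : R, forall n, cabs (clearedSum q a c n) <=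
    B * n.+1%:R ^+ 2 * Num.max 1 (cabs a) ^+ n.
Proof.
move=> q1 A0 cA; set M := Num.max 1 _; pose P n := \prod_(1 <= j < n.+1) (1 + cabs q ^+ j).
have M1 : 1 <= M by rewrite le_max lexx.
have aM : cabs a <= M by rewrite le_max lexx orbT.
have M0 : 0 <= M by exact: le_trans M1.
have cabsX (x : R[i]) k : cabs (x ^+ k) = cabs x ^+ k.
  by elim: k => [|k IH]; [exact: Normc.normc1 | rewrite !exprS cabsM IH].
have PS n : P n.+1 = P n * (1 + cabs q ^+ n.+1) by rewrite /P big_nat_recr.
have P1 n : 1 <= P n.
  elim: n => [|n IH]; first by rewrite /P big_geq.
  by rewrite PS mulr_ege1// lerDl exprn_ge0// cabs_ge0.
have step n : cabs (clearedSum q a c n) <= P n * A * n.+1%:R ^+ 2 * M ^+ n.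
  elim: n => [|n IH].
    by rewrite /= /P big_geq// mul1r expr1n expr0 mulr1; apply: le_trans (cA 0%N) _; rewrite mulr1.
  rewrite /= (le_trans (cabsD _ _))// !cabsM.
  have h1 : cabs (clearedSum q a c n) * cabs (q ^+ n.+1 - 1) <=
      P n.+1 * A * n.+1%:R ^+ 2 * M ^+ n.+1.
    rewrite PS; apply: (@le_trans _ _ (P n * A * n.+1%:R ^+ 2 * M ^+ n * (1 + cabs q ^+ n.+1))).
      rewrite ler_pM ?cabs_ge0// (le_trans (cabsD _ _))// cabsN cabsX addrC lerD2r.
      by rewrite (_ : cabs 1 = 1)//; exact: Normc.normc1.
    rewrite [leRHS](_ : _ = P n * A * n.+1%:R ^+ 2 * M ^+ n * (1 + cabs q ^+ n.+1) * M).
      rewrite ler_peMr// !mulr_ge0 ?exprn_ge0//; first by rewrite (le_trans _ (P1 n)).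
      by rewrite addr_ge0// exprn_ge0// cabs_ge0.
    by rewrite (exprSr M); ring.
  have h2 : cabs (c n.+1) * cabs (a ^+ n.+1) <= P n.+1 * A * n.+2%:R * M ^+ n.+1.
    rewrite cabsX ler_pM ?exprn_ge0 ?cabs_ge0//.
      rewrite (le_trans (cA _))// -mulrA ler_peMl// mulr_ge0//.
    by rewrite lerXn2r ?nnegrE ?cabs_ge0.
  apply: (le_trans (lerD h1 h2)).
  have Pn : 0 <= P n.+1 * A * M ^+ n.+1.
    by rewrite !mulr_ge0 ?exprn_ge0// (le_trans _ (P1 n.+1)).
  rewrite -[n.+2%:R]natr1; have k0 : 0 <= n.+1%:R :> R by [].
  move: Pn k0; set X := P n.+1; set Y := M ^+ n.+1; set K := n.+1%:R.
  move=> Pn k0.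
  have : 0 <= X * A * Y * K by exact: mulr_ge0.
  by nra.
exists (expR (1 - cabs q)^-1 * A) => n; apply: (le_trans (step n)).
rewrite -!mulrA ler_wpM2r ?mulr_ge0 ?exprn_ge0//.
by apply: prod_1p_geometric_le; rewrite cabs_ge0.
Qed.

(** As the series has sum 0, the partial sum is minus the tail, and the tail is
    at most twice the bound for its first term
    c_(n+1) a^(n+1) / [n+1]_q!. *)
Lemma clearedSum_le_tail {R : realType} (q a A : R) (c : nat -> R) :
  1 < `|q| -> 0 <= A -> (forall k, `|c k| <= A * k.+1%:R) ->
  series (fun k => c k * a ^+ k / qfact q k) @ \oo --> 0 ->
  exists B N, forall n, (N <= n)%N ->
    `|clearedSum q a c n| <= B * n.+1%:R ^+ 2 * (`|a| / `|q|) ^+ n.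
Proof.
move=> q1 A0 cA s0; have [N NP] := qfact_halving q1 A0 (normr_ge0 a).
have c0 := qgap_gt0 q1; have q0 : 0 < `|q| by rewrite (lt_trans ltr01).
exists (4 * A * (`|a| / `|q|) / (1 - `|q|^-1)), N => n Nn.
have fs k : `|c k * a ^+ k / qfact q k| <= A * k.+1%:R * `|a| ^+ k / `|qfact q k|.
  by rewrite !normrM normfV normrX !ler_wpM2r ?invr_ge0 ?exprn_ge0.
have := halving_tail_le fs NP s0 (leqW Nn); rewrite sub0r normrN => tail.
have fn0 : 0 < `|qfact q n| by rewrite normr_gt0 qfact_neq0.
have in0 : 0 < `|qint q n.+1| by rewrite normr_gt0 qint_neq0.
rewrite clearedSumE// normrM (le_trans (ler_wpM2l _ tail))// qfactS normrM.
have -> : `|qfact q n| * (2 * (A * n.+2%:R * `|a| ^+ n.+1 / (`|qfact q n| * `|qint q n.+1|)))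
  = 2 * A * n.+2%:R * `|a| ^+ n.+1 / `|qint q n.+1|.
  by field; rewrite !gt_eqF.
apply: (@le_trans _ _ (2 * A * n.+2%:R * `|a| ^+ n.+1 / (`|q| ^+ n.+1 * (1 - `|q|^-1)))).
  rewrite ler_wpM2l ?mulr_ge0 ?exprn_ge0//.
  by rewrite lef_pV2 ?posrE ?qint_ge// mulr_gt0// exprn_gt0.
have -> : 2 * A * n.+2%:R * `|a| ^+ n.+1 / (`|q| ^+ n.+1 * (1 - `|q|^-1)) =
  (2 * n.+2%:R) * (A * (`|a| / `|q|) / (1 - `|q|^-1) * (`|a| / `|q|) ^+ n).
  rewrite expr_div_n !exprS invfM; field.
  by rewrite expf_neq0 ?subr_eq0 ?gt_eqF.
have -> : 4 * A * (`|a| / `|q|) / (1 - `|q|^-1) * n.+1%:R ^+ 2 * (`|a| / `|q|) ^+ n =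
  (4 * n.+1%:R ^+ 2) * (A * (`|a| / `|q|) / (1 - `|q|^-1) * (`|a| / `|q|) ^+ n) by ring.
rewrite ler_wpM2r//.
  by rewrite !mulr_ge0 ?exprn_ge0 ?divr_ge0 ?invr_ge0// ltW.
rewrite -natrX -!natrM ler_nat; lia.
Qed.

(** * Vanishing of the coefficients *)

Lemma min1_max1 {R : realDomainType} (x : R) : Num.min 1 x * Num.max 1 x = x.
Proof. by rewrite minElt maxElt; case: ifP; rewrite ?mul1r ?mulr1. Qed.

Lemma generator_integral {R : realType} (q : R) : integralOver (intr : int -> R) q ->
  integralOver (intr : int -> numField q) (generator q).
Proof. by move=> ?; apply: (@integralOver_fmorph _ _ (val : {rmorphism numField q -> R})). Qed.

(** The product of the growth rates over all embeddings is
    min(1, |a|) H_q(a) / |q| < 1, so the cleared sums, being algebraic integers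
    whose norm tends to 0, vanish from some index on. *)
Lemma coefficients_eventually_zero {R : realType} (q : R) (a : numField q)
    (c : nat -> numField q) :
  PV_number q \/ PV_number (- q) ->
  ringOfIntegers a -> (forall k, ringOfIntegers (c k)) ->
  (forall s : {rmorphism numField q -> R[i]}, exists2 A : R, 0 <= A &
    forall k, cabs (s (c k)) <= A * k.+1%:R) ->
  0 < Num.min 1 `|a : R| * relHeight a < `|q| ->
  series (fun k => (c k : R) * (a : R) ^+ k / qfact q k) @ \oo --> 0 ->
  \forall n \near \oo, c n = 0.
Proof.
move=> hq a_int c_int c_le /andP[h0 h1] ser0.
have q1 := PV_norm_gt1 hq; have q0 : 0 < `|q| by rewrite (lt_trans ltr01).
have q_int := PV_integral hq.
pose b n := clearedSum (generator q) a c n.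
have b_int n : ringOfIntegers (b n).
  by apply: clearedSum_integral => //; exact: generator_integral.
have bE n : (b n : R) = clearedSum q (a : R) (fun k => c k : R) n.
  exact: (clearedSum_rmorph (val : {rmorphism numField q -> R})).
pose e : numField q -> R[i] := realEmbedding q.
(* The exponential growth rate of the cleared sums at the embedding s. *)
pose T (s : numField q -> R[i]) :=
  if s == e then `|a : R| / `|q| else Num.max 1 (cabs (s a)).
have T0 s : 0 <= T s.
  by rewrite /T; case: ifP => _; [rewrite divr_ge0 | rewrite le_max ler01].
have bound (s : numField q -> R[i]) : exists BN : R * nat, embeddings s ->
    forall n, (BN.2 <= n)%N -> cabs (s (b n)) <= BN.1 * n.+1%:R ^+ 2 * T s ^+ n.
  have [|] := pselect (embeddings s); last by exists (0, 0%N).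
  move=> [s' _ <-]; have [A A0 cA] := c_le s'; rewrite /T; case: eqVneq => [s'e|s'e].
    have cA' k : `|c k : R| <= A * k.+1%:R by rewrite -cabs_real -[X in cabs X]/(e (c k)) -s'e.
    have [B [N BN]] := clearedSum_le_tail q1 A0 cA' ser0.
    exists (B, N) => _ n /BN; rewrite s'e /e cabs_real -bE; exact.
  have [s'e'|sq1] := PV_conjugate s' hq; first by rewrite s'e' eqxx in s'e.
  have [B HB] := clearedSum_le_disk (s' a) sq1 A0 cA.
  by exists (B, 0%N) => _ n _; rewrite clearedSum_rmorph; exact: HB.
have [BN {}bound] := choice bound.
have [r r_uniq rE] := embeddings_seq q_int.
have er : e \in r by have : @embeddings R q e; [exists (realEmbedding q)|rewrite rE].
pose th := \prod_(s <- r) T s.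
have th01 : 0 <= th < 1.
  rewrite prodr_ge0//=.
  have <- : (Num.min 1 `|a : R| * relHeight a) / `|q| = th.
    rewrite /relHeight rE -fsbig_seq// /th.
    rewrite !(bigD1_seq e er r_uniq) {1}/T eqxx cabs_real mulrA min1_max1.
    rewrite mulrAC; congr (_ * _); apply: eq_bigr => s se.
    by rewrite /T (negPf se).
  by rewrite ltr_pdivrMr// mul1r.
have Hb := poly_geometric_lt1 (\prod_(s <- r) (BN s).1) (2 * size r) th01.
have [N _ b0] : \forall n \near \oo, b n = 0.
  near=> n; apply/eqP; apply: contraT => /(norm_ge1 q_int (b_int n)).
  rewrite rE -fsbig_seq// leNgt => /negP; case.
  have nN : (\max_(s <- r) (BN s).2 <= n)%N by near: n; exact: nbhs_infty_ge.
  apply: le_lt_trans (_ : _ <= \prod_(s <- r) (BN s).1 * n.+1%:R ^+ (2 * size r) * th ^+ n) _.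
    rewrite (_ : _ * _ * _ = \prod_(s <- r) ((BN s).1 * n.+1%:R ^+ 2 * T s ^+ n)).
      rewrite big_seq [leRHS]big_seq; apply: ler_prod => s sr; rewrite cabs_ge0/=.
      apply: bound; first by rewrite rE.
      by apply: leq_trans nN; apply: leq_bigmax_seq.
    rewrite !big_split /= prodrXl; congr (_ * _ * _).
    by rewrite !big_const_seq !count_predT !iter_mulr_1 -expr2 -exprM mulnC.
  by near: n; exact: Hb.
have a0 : a != 0.
  by apply: contraTneq h0 => ->; rewrite normr0 minEle ler10 mul0r ltxx.
exists N.+1 => // -[//|n] /= Nn; apply/eqP.
have := b0 n.+1 (leqW Nn); rewrite /b /= -/(b n) (b0 n Nn) mul0r add0r.
by move/eqP; rewrite mulf_eq0 (negPf (expf_neq0 _ a0)) orbF.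
Unshelve. all: by end_near. Qed.

Lemma norm_le_relHeight {R : realType} (q : R) (a : numField q) :
  integralOver (intr : int -> R) q ->
  `|a : R| <= Num.min 1 `|a : R| * relHeight a.
Proof.
move=> /embeddings_seq[r r_uniq rE].
pose e : numField q -> R[i] := realEmbedding q.
have er : e \in r by have : @embeddings R q e; [exists (realEmbedding q)|rewrite rE].
rewrite /relHeight rE -fsbig_seq// (bigD1_seq e er r_uniq) cabs_real mulrA min1_max1.
rewrite ler_peMr//; elim/big_ind: _ => [//|x y|s _]; first exact: mulr_ege1.
by rewrite le_max lexx.
Qed.

(** Elements of the span of [u] and [v] over the integers have a common
    denominator; multiplying by it reduces to integral coefficients. *)
Lemma integer_combination_eventually_zero {R : realType} (q : R) (a u v : numField q)
    (m n : nat -> int) :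
  PV_number q \/ PV_number (- q) -> ringOfIntegers a ->
  0 < Num.min 1 `|a : R| * relHeight a < `|q| ->
  (forall k, `|m k| <= k.+1%:Z) -> (forall k, `|n k| <= k.+1%:Z) ->
  series (fun k => ((m k)%:~R * (u : R) + (n k)%:~R * (v : R)) * (a : R) ^+ k / qfact q k)
    @ \oo --> 0 ->
  \forall k \near \oo, (m k)%:~R * (u : R) + (n k)%:~R * (v : R) = 0.
Proof.
move=> hq a_int ha mk nk ser0; have q_int := PV_integral hq.
have [d d0 du] := numField_denominator u q_int.
have [d' d'0 d'v] := numField_denominator v q_int.
pose c k : numField q := (d * d')%:~R * ((m k)%:~R * u + (n k)%:~R * v).
have cE k : (c k : R) = (d * d')%:~R * ((m k)%:~R * (u : R) + (n k)%:~R * (v : R)).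
  pose f : {rmorphism numField q -> R} := val.
  by rewrite -[LHS]/(f (c k)) /c !(rmorphM f, rmorphD f, rmorph_int f).
have z_int (z : int) : integralOver (intr : int -> numField q) z%:~R by exact: integral_id.
have cabs_int (z : int) : cabs (z%:~R : R[i]) = `|z|%:~R.
  by rewrite -(rmorph_int (real_complex R) z) cabs_real intr_norm.
have c_int k : ringOfIntegers (c k).
  rewrite (_ : c k = (d' * m k)%:~R * (d%:~R * u) + (d * n k)%:~R * (d'%:~R * v)).
    by apply: integral_add; apply: integral_mul.
  by rewrite /c !intrM; ring.
have c_le (s : {rmorphism numField q -> R[i]}) : exists2 A : R, 0 <= A &
    forall k, cabs (s (c k)) <= A * k.+1%:R.
  exists (`|d * d'|%:~R * (cabs (s u) + cabs (s v))).
    by rewrite mulr_ge0 ?addr_ge0 ?cabs_ge0// ler0z.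
  move=> k; rewrite /c rmorphM cabsM rmorph_int cabs_int -mulrA ler_wpM2l ?ler0z//.
  rewrite rmorphD !rmorphM !rmorph_int (le_trans (cabsD _ _))// !cabsM !cabs_int.
  by rewrite mulrDl lerD// mulrC ler_wpM2l ?cabs_ge0// -[leRHS]/(k.+1%:Z%:~R) ler_int.
have : \forall k \near \oo, c k = 0.
  apply: (coefficients_eventually_zero hq a_int c_int c_le ha).
  rewrite -[X in _ --> X](mulr0 (d * d')%:~R).
  rewrite (_ : (fun k => _) = fun k => (d * d')%:~R *
    (((m k)%:~R * (u : R) + (n k)%:~R * (v : R)) * (a : R) ^+ k / qfact q k)).
    exact: cvg_seriesM.
  by apply/funext => k; rewrite cE !mulrA.
apply: filterS => k /(congr1 (@numField_val R q)); rewrite cE => /eqP.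
by rewrite mulf_eq0 intr_eq0 mulf_eq0 (negPf d0) (negPf d'0) /= => /eqP.
Qed.

(** * Irrationality *)

Lemma cvg_qexp {R : realType} (q x : R) : 1 < `|q| ->
  series (fun k => x ^+ k / qfact q k) @ \oo --> qexp q x.
Proof.
move=> q1; set f := fun k => x ^+ k / qfact q k.
have /normed_cvg/cvg_ex[l fl] : cvgn [normed series f].
  apply: (@qfact_dominated_cvg _ q 1 x) => // k.
  rewrite normrM normrX normfV mul1r ler_wpM2r ?invr_ge0//.
  by rewrite ler_peMl ?exprn_ge0// ler1n.
suff -> : qexp q x = l by [].
rewrite /qexp; suff /cvg_lim -> : (fun n => \sum_(1 <= k < n) f k) @ \oo --> l - 1.
- by rewrite addrC subrK.
- exact: Rhausdorff.
rewrite -(cvg_shiftn 1).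
rewrite (_ : [sequence _]_n = fun n => series f (n + 1)%N - 1).
  by apply: cvgB; [rewrite (cvg_shiftn 1)|exact: cvg_cst].
apply/funext => n /=; rewrite addn1 /series /= [in RHS]big_nat_recl//= big_add1 /=.
by rewrite /f expr0 qfact0 divr1 addrAC subrr add0r.
Qed.

(** The coefficients are 1 - E_q(a) for k = 0 and 1 for k >= 1. *)
Lemma qexp_notin {R : realType} (q : R) (a : numField q) :
  PV_number q \/ PV_number (- q) -> ringOfIntegers a ->
  0 < Num.min 1 `|a : R| * relHeight a < `|q| ->
  qexp q a \notin adjoinQ q.
Proof.
move=> hq a_int ha; apply/negP => eQ; pose v := NumField eQ.
have q1 := PV_norm_gt1 hq.
have : \forall k \near \oo, (1%:Z)%:~R * (1 : R) + (- (k == 0%N)%:Z)%:~R * (v : R) = 0.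
  apply: (@integer_combination_eventually_zero _ _ a 1 v (fun=> 1)
    (fun k => - (k == 0%N)%:Z)) => //.
    by case.
  have dl : series (fun k => (a : R) ^+ k / qfact q k) (n + 1)%N - qexp q a @[n --> \oo]
      --> qexp q a - qexp q a.
    apply: cvgB; last exact: cvg_cst.
    by rewrite (cvg_shiftn 1); exact: cvg_qexp.
  rewrite subrr in dl; rewrite -(cvg_shiftn 1) (_ : [sequence _]_n = fun n =>
    series (fun k => (a : R) ^+ k / qfact q k) (n + 1)%N - qexp q a)//.
  apply/funext => n /=; rewrite addn1 /series /= !big_nat_recl//= [RHS]addrAC; congr +%R.
    by rewrite !expr0 qfact0 !divr1 mulr1 mul1r mulrN1z mulN1r.
  by apply: eq_bigr => k _; rewrite oppr0 mulr0z mul0r addr0 mulr1 mul1r.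
move=> [N _ /(_ N.+1 (leqnSn N))] /= /eqP.
by rewrite oppr0 mulr0z mul0r addr0 mulr1 oner_eq0.
Qed.

(** The coefficients are (-1)^k (L_q(a) + k); two consecutive ones cannot both
    vanish. *)
Lemma qlog_notin {R : realType} (q : R) (a : numField q) :
  PV_number q \/ PV_number (- q) -> ringOfIntegers a ->
  0 < Num.min 1 `|a : R| * relHeight a < `|q| ->
  qlog q a \notin adjoinQ q.
Proof.
move=> hq a_int ha; apply/negP => lQ; pose u := NumField lQ.
have q1 := PV_norm_gt1 hq.
have aq : `|a : R| < `|q|.
  by have /andP[_] := ha; apply: le_lt_trans; exact/norm_le_relHeight/PV_integral.
have : \forall k \near \oo, ((-1) ^+ k : int)%:~R * (u : R) + ((-1) ^+ k * k%:Z)%:~R * (1 : R) = 0.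
  apply: (@integer_combination_eventually_zero _ _ a u 1 (fun k => (-1) ^+ k)
    (fun k => (-1) ^+ k * k%:Z)) => //.
  - by move=> k; rewrite normrX normrN1 expr1n.
  - by move=> k; rewrite normrM normrX normrN1 expr1n mul1r lez_nat.
  rewrite (_ : (fun k => _) = fun k =>
    (-1) ^+ k * (qlog q (a : R) + k%:R) * (a : R) ^+ k / qfact q k).
    exact: qlog_log_derivative.
  by apply/funext => k; rewrite intrM rmorphXn rmorphN1 /= mulr1 -mulrDr.
move=> [N _ NP]; have := NP N (leqnn N); have := NP N.+1 (leqnSn N).
have s0 k : ((-1) ^+ k : int)%:~R != 0 :> R by rewrite intr_eq0 signr_eq0.
rewrite !intrM !mulr1 -!mulrDr => /eqP; rewrite mulf_eq0 (negPf (s0 _)) => /eqP h1.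
move=> /eqP; rewrite mulf_eq0 (negPf (s0 _)) => /eqP h2.
have /addrI/intr_inj/eqP := etrans h1 (esym h2).
by rewrite eqz_nat gtn_eqF.
Qed.

Unset Implicit Arguments.

Theorem corollary1p2 (R : realType) (q : R) (hq : PV_number q \/ PV_number (- q)) :
  (forall alpha : numField q,
     ringOfIntegers alpha ->
     0 < Num.min 1 `|alpha : R| * relHeight alpha < `|q| ->
     qexp q alpha \notin adjoinQ q /\ qlog q alpha \notin adjoinQ q) /\
  irrational (qzeta1 q).
Proof.
split=> [a a_int ha|]; first by split; [exact: qexp_notin | exact: qlog_notin].
move=> [r _ rE].
have one_int : ringOfIntegers (1 : numField q) by exact: integral1.
have height1 : 0 < Num.min 1 `|(1 : numField q) : R| * relHeight (1 : numField q) < `|q|.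
  rewrite (_ : numField_val 1 = 1)// normr1 minxx mul1r /relHeight fsbig1.
    by rewrite ltr01 PV_norm_gt1.
  by move=> _ [s _ <-]; rewrite rmorph1 (_ : cabs 1 = 1) ?maxxx//; exact: Normc.normc1.
have /negP := qlog_notin hq one_int height1; apply.
suff -> : qlog q (1 : numField q) = ratr r by exact: rpred_rat.
rewrite rE /qlog /qzeta1 (_ : numField_val 1 = 1)//.
by under eq_fun do under eq_bigr do rewrite expr1n mul1r.
Qed.
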